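(* Let $L\in\mathbb{R}^{n\times n}$ be the Laplacian of a connected undirected graph on $n$ nodes, let $\kappa_1,\dots,\kappa_n>0$, and let $N_l$ be an integer with $1\le N_l<n$. Write $D_\kappa=\mathrm{diag}(\kappa)$, $D_x=\mathrm{diag}(x)$ and $J(x)=\mathrm{trace}\big((L+D_\kappa D_x)^{-1}\big)$. (i) $J$ is a convex function of $x$ on the set of $x\in\mathbb{R}^n$ for which $L+D_\kappa D_x$ is positive definite. (ii) Let $J_{\rm opt}$ denote the minimum of $J(x)$ over all $x\in\{0,1\}^n$ with $\mathbf{1}^Tx=N_l$ (the noise-corrupted leader selection problem). Consider the relaxed problem of minimizing $J(x)$ subject to $\mathbf{1}^Tx=N_l$ and $0\le x_i\le 1$ for $i=1,\dots,n$. This is a convex optimization problem, and any solution $x^*$ of it satisfies $J(x^* )\le J_{\rm opt}$. If moreover $x^*\in\{0,1\}^n$, then $x^*$ is a global solution of the noise-corrupted leader selection problem. (iii) The relaxed problem in (ii) is equivalent to the semidefinite program of minimizing $\mathrm{trace}(X)$ over symmetric $X\in\mathbb{R}^{n\times n}$ and $x\in\mathbb{R}^n$ subject to $$\begin{bmatrix} X & I\\ I & L+D_\kappa D_x\end{bmatrix}\succeq 0,\qquad \mathbf{1}^Tx=N_l,\qquad 0\le x_i\le 1,\ \ i=1,\dots,n.$$ That is, the two problems have the same optimal value, and $x$ is optimal for the relaxed problem if and only if there is an $X$ such that $(X,x)$ is optimal for the semidefinite program.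
   Context: $\mathbf{1}$ is the vector of all ones, $\mathrm{diag}(v)$ is the diagonal matrix with the vector $v$ on its diagonal, $I$ is the $n\times n$ identity, and $M\succeq 0$ means that the symmetric matrix $M$ is positive semidefinite. The graph Laplacian $L$ of a connected undirected graph is symmetric positive semidefinite with a simple eigenvalue $0$ and eigenvector $\mathbf{1}$. An entry $x_i=1$ means node $i$ is a leader and $x_i=0$ means node $i$ is a follower. $N_l$ is the prescribed number of leaders. *)

(* Defs.v *)
From HB Require Import structures.
From mathcomp Require Import all_boot all_order all_algebra.
From mathcomp Require Import all_classical all_reals ereal convex.

Set Implicit Arguments.
Unset Strict Implicit.
Unset Printing Implicit Defensive.

Import Order.TTheory GRing.Theory Num.Theory.
Local Open Scope classical_set_scope.
Local Open Scope ring_scope.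

(* A simple graph on 'I_n is a symmetric irreflexive relation; vectors of R^n
   are row vectors, the convention of diag_mx. *)

Definition connected_graph (n : nat) (e : rel 'I_n) : Prop :=
  forall i j, connect e i j.

Definition laplacian (R : realType) (n : nat) (e : rel 'I_n) : 'M[R]_n :=
  diag_mx (\row_i #|[set j | e i j]%SET|%:R) - \matrix_(i, j) (e i j)%:R.

Definition posdefmx (R : realType) (n : nat) (M : 'M[R]_n) : Prop :=
  M \is symmetricmx /\ forall v : 'rV[R]_n, v != 0 -> 0 < (v *m M *m v^T) 0 0.

Definition possemidefmx (R : realType) (n : nat) (M : 'M[R]_n) : Prop :=
  M \is symmetricmx /\ forall v : 'rV[R]_n, 0 <= (v *m M *m v^T) 0 0.

Section Optimization.
Context (R : realType) (T : Type).
Implicit Types (D : set T) (f : T -> R).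

Definition solution D f (x : T) : Prop :=
  D x /\ forall y, D y -> f x <= f y.

Definition minimum D f (v : R) : Prop := exists2 x, solution D f x & f x = v.

(* Need not be attained; it is +oo when D is empty. *)
Definition optimal_value D f : \bar R := ereal_inf [set (f x)%:E | x in D].

End Optimization.

Definition convex_problem (R : realType) (E : lmodType R) (D : set E)
    (f : E -> R) : Prop :=
  convex_set D /\ convex_function D f.

Section LeaderSelection.
Context (R : realType) (n : nat).
Variables (L : 'M[R]_n) (kappa : 'rV[R]_n) (Nl : nat).
Implicit Type x : 'rV[R]_n.

Definition grounded x : 'M[R]_n := L + diag_mx kappa *m diag_mx x.

(* invmx M = M when M is singular, so J is meaningful only where grounded x is
   invertible, in particular on J_domain. *)
Definition J x : R := \tr (invmx (grounded x)).

Definition J_domain : set 'rV[R]_n := [set x | posdefmx (grounded x)].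

Definition boolean_vector x : Prop := forall i, x 0 i = 0 \/ x 0 i = 1.

Definition leader_feasible : set 'rV[R]_n :=
  [set x | boolean_vector x /\ \sum_i x 0 i = Nl%:R].

Definition relaxed_feasible : set 'rV[R]_n :=
  [set x | \sum_i x 0 i = Nl%:R /\ forall i, 0 <= x 0 i <= 1].

Definition sdp_feasible : set ('M[R]_n * 'rV[R]_n) :=
  [set Xx | [/\ Xx.1 \is symmetricmx,
                possemidefmx (block_mx Xx.1 1%:M 1%:M (grounded Xx.2)),
                \sum_i Xx.2 0 i = Nl%:R &
                forall i, 0 <= Xx.2 0 i <= 1]].

Definition sdp_objective (Xx : 'M[R]_n * 'rV[R]_n) : R := \tr Xx.1.

End LeaderSelection.

(* Main.v *)
Require Import Defs.
From HB Require Import structures.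
From mathcomp Require Import all_boot all_order all_algebra.
From mathcomp Require Import all_classical all_reals ereal convex.
From mathcomp Require Import ring lra.

Set Implicit Arguments.
Unset Strict Implicit.
Unset Printing Implicit Defensive.

Import Order.TTheory GRing.Theory Num.Theory.
Local Open Scope classical_set_scope.
Local Open Scope ring_scope.

(** For A positive definite, completing the square gives
    v A^-1 v^T = max_w (2 v w^T - w A w^T).
    The maximand is affine in A, so each diagonal entry of A^-1 is convex in A,
    and J is convex because L + D_kappa D_x is affine in x. The same inequality,
    tested on w = v A^-1, is the part of the Schur complement criterion needed
    for the semidefinite program: trace X >= trace A^-1, with X = A^-1 feasible.
    A relaxed feasible x has a positive entry, and a vector annihilated by the
    Laplacian form is constant on a connected graph, so L + D_kappa D_x is
    positive definite. *)

(** * Symmetric matrices and bilinear forms *)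

Lemma symmetricmxP (R : fieldType) (n : nat) (M : 'M[R]_n) :
  M \is symmetricmx <-> M^T = M.
Proof.
rewrite qualifE expr0 scale1r map_mx_id //; split=> [/eqP //|H].
by apply/eqP.
Qed.

(** Keeping two separate arguments lets the square be expanded by bilinearity; with equal arguments
    it unfolds to the quadratic form in [posdefmx] and [possemidefmx]. *)
Definition mxform (R : comNzRingType) (n : nat) (A : 'M[R]_n)
    (v w : 'rV[R]_n) : R := (v *m A *m w^T) 0 0.

Section MatrixForm.
Context (R : comNzRingType) (n : nat).
Implicit Types (A B X : 'M[R]_n) (u v w : 'rV[R]_n).

Lemma mxformDl A u v w : mxform A (u + v) w = mxform A u w + mxform A v w.
Proof. by rewrite /mxform !mulmxDl mxE. Qed.

Lemma mxformDr A u v w : mxform A u (v + w) = mxform A u v + mxform A u w.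
Proof. by rewrite /mxform linearD mulmxDr mxE. Qed.

Lemma mxformNl A u v : mxform A (- u) v = - mxform A u v.
Proof. by rewrite /mxform !mulNmx mxE. Qed.

Lemma mxformNr A u v : mxform A u (- v) = - mxform A u v.
Proof. by rewrite /mxform linearN mulmxN mxE. Qed.

Lemma mxformD A B u v : mxform (A + B) u v = mxform A u v + mxform B u v.
Proof. by rewrite /mxform mulmxDr mulmxDl mxE. Qed.

Lemma mxformB A B u v : mxform (A - B) u v = mxform A u v - mxform B u v.
Proof. by rewrite /mxform mulmxBr mulmxBl !mxE. Qed.

Lemma mxformZ a A u v : mxform (a *: A) u v = a * mxform A u v.
Proof. by rewrite /mxform -scalemxAr -scalemxAl mxE. Qed.

Lemma mxformC A u v : A^T = A -> mxform A u v = mxform A v u.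
Proof.
move=> sA; rewrite /mxform.
have -> : u *m A *m v^T = (v *m A *m u^T)^T by rewrite !trmx_mul trmxK sA mulmxA.
by rewrite mxE.
Qed.

Lemma mxformE A u v : mxform A u v = \sum_i \sum_j u 0 i * A i j * v 0 j.
Proof.
rewrite /mxform mxE exchange_big; apply: eq_bigr => j _ /=.
by rewrite !mxE mulr_suml.
Qed.

Lemma mxform_delta A i : mxform A (delta_mx 0 i) (delta_mx 0 i) = A i i.
Proof. by rewrite /mxform -rowE trmx_delta -colE !mxE. Qed.

Lemma mxform_diag (d v : 'rV[R]_n) :
  mxform (diag_mx d) v v = \sum_i d 0 i * v 0 i ^+ 2.
Proof.
rewrite mxformE; apply: eq_bigr => i _.
rewrite (bigD1 i) //= big1 => [|j ji]; last first.
  by rewrite mxE eq_sym (negbTE ji) mulr0n mulr0 mul0r.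
by rewrite mxE eqxx mulr1n addr0 expr2 mulrAC mulrC.
Qed.

Lemma mxform_block A X v w :
  (row_mx v w *m block_mx X 1%:M 1%:M A *m (row_mx v w)^T) 0 0
  = mxform X v v + mxform 1%:M v w *+ 2 + mxform A w w.
Proof.
rewrite mul_row_block tr_row_mx mul_row_col.
transitivity (mxform X v v + mxform 1%:M w v + (mxform 1%:M v w + mxform A w w)).
  by rewrite /mxform !mulmxDl !mxE.
by rewrite (@mxformC _ w v) ?trmx1 // mulr2n !addrA.
Qed.

End MatrixForm.

(** * Inverses and Schur complements of positive definite matrices *)

Section PositiveDefinite.
Context (R : realType) (n : nat).
Implicit Types (A B X : 'M[R]_n) (v w : 'rV[R]_n).

Lemma posdefmx_ge0 A v : posdefmx A -> 0 <= mxform A v v.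
Proof.
move=> [_ pA]; have [->|/pA/ltW//] := eqVneq v 0.
by rewrite /mxform !mul0mx mxE.
Qed.

(** A nonzero row of the left kernel would have quadratic form zero. *)
Lemma posdefmx_unit A : posdefmx A -> A \in unitmx.
Proof.
move=> [_ pA]; rewrite -row_free_unit -kermx_eq0; apply/eqP/row_matrixP => i.
rewrite row0; apply/eqP/negPn/negP => /pA.
by rewrite -row_mul mulmx_ker row0 mul0mx mxE ltxx.
Qed.

Lemma posdefmx_sym A : posdefmx A -> A^T = A.
Proof. by case=> /symmetricmxP. Qed.

Lemma posdefmx_conv A B (t : R) : 0 <= t <= 1 -> posdefmx A -> posdefmx B ->
  posdefmx (t *: A + (1 - t) *: B).
Proof.
move=> /andP[t0 t1] pA pB; split.
  by apply/symmetricmxP; rewrite linearD /= !linearZ /= !posdefmx_sym.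
move=> v v0; rewrite -/(mxform _ v v) mxformD !mxformZ.
have a0 : 0 < mxform A v v by case: pA => _; apply.
have b0 : 0 < mxform B v v by case: pB => _; apply.
nra.
Qed.

Lemma mxform_invmx A v w : A \in unitmx ->
  mxform A (v *m invmx A) w = mxform 1%:M v w.
Proof. by move=> uA; rewrite /mxform mulmxKV // mulmx1. Qed.

Lemma mxform_invmx2 A v : A \in unitmx -> A^T = A ->
  mxform A (v *m invmx A) (v *m invmx A) = mxform (invmx A) v v.
Proof.
move=> uA sA; rewrite mxform_invmx // /mxform trmx_mul trmx_inv sA.
by rewrite mulmx1 mulmxA.
Qed.

Lemma mxform_square A v w : posdefmx A ->
  mxform A (w - v *m invmx A) (w - v *m invmx A)
  = mxform A w w - mxform 1%:M v w *+ 2 + mxform (invmx A) v v.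
Proof.
move=> pA; have uA := posdefmx_unit pA; have sA := posdefmx_sym pA.
rewrite !(mxformDl, mxformDr, mxformNl, mxformNr) (@mxformC _ _ A w) //.
by rewrite mxform_invmx2 // mxform_invmx //; ring.
Qed.

Lemma mxform_inv_ge A v w : posdefmx A ->
  mxform 1%:M v w *+ 2 - mxform A w w <= mxform (invmx A) v v.
Proof.
move=> pA; have := posdefmx_ge0 (w - v *m invmx A) pA.
rewrite mxform_square //; lra.
Qed.

(** At w = v A^-1 the completed square vanishes, so the bound of [mxform_inv_ge] is sharp. *)
Lemma mxform_inv_attained A v : posdefmx A ->
  mxform (invmx A) v v
  = mxform 1%:M v (v *m invmx A) *+ 2 - mxform A (v *m invmx A) (v *m invmx A).
Proof.
move=> pA; have := mxform_square v (v *m invmx A) pA.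
rewrite subrr {1}/mxform !mul0mx mxE => h; lra.
Qed.

Lemma mxtrace_invmx_conv A B (t : R) : 0 <= t <= 1 -> posdefmx A -> posdefmx B ->
  \tr (invmx (t *: A + (1 - t) *: B))
  <= t * \tr (invmx A) + (1 - t) * \tr (invmx B).
Proof.
move=> t01 pA pB; rewrite /mxtrace !mulr_sumr -big_split; apply: ler_sum => i _ /=.
rewrite -[X in X <= _]mxform_delta -[X in _ * X + _]mxform_delta.
rewrite -[X in _ <= _ + _ * X]mxform_delta.
set v := delta_mx 0 i; rewrite mxform_inv_attained; last exact: posdefmx_conv.
(* This w is the maximizer for the combined matrix. The maximand at w is affine in the matrix, and
   at A and B it is bounded by the respective maxima. *)
set w := v *m _; rewrite mxformD !mxformZ.
have hA := mxform_inv_ge v w pA; have hB := mxform_inv_ge v w pB.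
case/andP: t01 => t0 t1; nra.
Qed.

Lemma mxtrace_invmx_le_schur A X : posdefmx A ->
  possemidefmx (block_mx X 1%:M 1%:M A) -> \tr (invmx A) <= \tr X.
Proof.
move=> pA [_ h]; apply: ler_sum => i _.
rewrite -[X in X <= _]mxform_delta -[X in _ <= X]mxform_delta.
(* For fixed v, the second block - v A^-1 minimizes the block form; the value left is the i-th
   diagonal entry of X - A^-1. *)
set v := delta_mx 0 i; have := h (row_mx v (- (v *m invmx A))).
rewrite mxform_block mxform_inv_attained // !(mxformNl, mxformNr); lra.
Qed.

Lemma possemidefmx_schur_inv A : posdefmx A ->
  possemidefmx (block_mx (invmx A) 1%:M 1%:M A).
Proof.
move=> pA; split.
  by apply/symmetricmxP; rewrite tr_block_mx trmx_inv posdefmx_sym // trmx1.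
move=> u; rewrite -(hsubmxK u) mxform_block.
(* The block form carries the cross term with a plus sign, hence the negated second half. *)
have := mxform_inv_ge (lsubmx u) (- rsubmx u) pA.
rewrite !(mxformNl, mxformNr); lra.
Qed.

End PositiveDefinite.

(** * The Laplacian form and positive definiteness of the grounded Laplacian *)

Section Laplacian.
Context (R : realType) (n : nat) (e : rel 'I_n).
Hypotheses (e_sym : symmetric e) (e_conn : connected_graph e).
Implicit Types (kappa x v : 'rV[R]_n).

Lemma laplacian_sym : (laplacian R e)^T = laplacian R e.
Proof.
rewrite /laplacian linearB /= tr_diag_mx; congr (_ - _).
by apply/matrixP => i j; rewrite !mxE e_sym.
Qed.

(** The double sum runs over ordered pairs, so each edge is counted twice; doubling the left side
    avoids a division. *)
Lemma laplacian_form v :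
  mxform (laplacian R e) v v *+ 2
  = \sum_i \sum_j (e i j)%:R * (v 0 i - v 0 j) ^+ 2.
Proof.
rewrite /laplacian mxformB mxform_diag mxformE.
have degE i : #|[set j | e i j]%SET|%:R = \sum_j (e i j)%:R :> R.
  rewrite -sum1_card natr_sum big_mkcond; apply: eq_bigr => j _ /=.
  by rewrite inE; case: (e i j).
under eq_bigr => i _ do rewrite mxE degE mulr_suml.
rewrite -sumrB.
set S := (X in X *+ 2 = _).
(* Writing the degree as a sum over neighbours gives [S1]; exchanging i and j, by symmetry of [e],
   gives [S2]. Their sum completes the square (v_i - v_j)^2 on every edge. *)
have S1 : S = \sum_i \sum_j (e i j)%:R * (v 0 i ^+ 2 - v 0 i * v 0 j).
  apply: eq_bigr => i _; rewrite -sumrB; apply: eq_bigr => j _.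
  by rewrite mxE; ring.
have S2 : S = \sum_i \sum_j (e i j)%:R * (v 0 j ^+ 2 - v 0 i * v 0 j).
  rewrite S1 exchange_big; apply: eq_bigr => i _; apply: eq_bigr => j _ /=.
  by rewrite e_sym [v 0 j * _]mulrC.
rewrite mulr2n {1}S1 S2 -big_split; apply: eq_bigr => i _ /=.
by rewrite -big_split; apply: eq_bigr => j _ /=; ring.
Qed.

Lemma laplacian_ge0 v : 0 <= mxform (laplacian R e) v v.
Proof.
rewrite -(pmulrn_lge0 _ (n := 2)) // laplacian_form.
by apply: sumr_ge0 => i _; apply: sumr_ge0 => j _; rewrite mulr_ge0 // sqr_ge0.
Qed.

(** A vanishing sum of nonnegative terms has all terms zero, so v agrees across each edge, and by
    induction along any path. *)
Lemma laplacian_kernel v i j : mxform (laplacian R e) v v = 0 -> v 0 i = v 0 j.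
Proof.
move=> h; have h2 := laplacian_form v; rewrite h mul0rn in h2.
have p k l : true -> 0 <= (e k l)%:R * (v 0 k - v 0 l) ^+ 2.
  by move=> _; rewrite mulr_ge0 // sqr_ge0.
have edge k l : e k l -> v 0 k = v 0 l.
  move=> ekl; have /eqP := esym h2; rewrite psumr_eq0; last first.
    by move=> m _; apply: sumr_ge0 => l2 _; apply: p.
  move=> /allP /(_ k (mem_index_enum k)) /=; rewrite psumr_eq0; last exact: p.
  move=> /allP /(_ l (mem_index_enum l)) /=.
  by rewrite ekl mul1r sqrf_eq0 subr_eq0 => /eqP.
have /connectP[p' pth ->] := e_conn i j.
by elim: p' i pth => //= k p' IH i /andP[/edge -> /IH].
Qed.

Lemma grounded_sym kappa x : (grounded (laplacian R e) kappa x)^T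
  = grounded (laplacian R e) kappa x.
Proof. by rewrite /grounded linearD /= laplacian_sym mulmx_diag tr_diag_mx. Qed.

Lemma grounded_posdef kappa x i : (forall j, 0 < kappa 0 j) ->
  (forall j, 0 <= x 0 j) -> 0 < x 0 i ->
  posdefmx (grounded (laplacian R e) kappa x).
Proof.
move=> k0 x0 xi; split; first by apply/symmetricmxP/grounded_sym.
move=> v v0; rewrite -/(mxform _ v v) /grounded mxformD mulmx_diag mxform_diag.
have q0 j : true -> 0 <= (\row_l (kappa 0 l * x 0 l)) 0 j * v 0 j ^+ 2.
  by move=> _; rewrite mxE mulr_ge0 ?sqr_ge0 // mulr_ge0 // ltW.
(* Both summands are nonnegative, so if the form is zero each vanishes: the diagonal part forces v_i
   = 0 at the node with positive x_i, and the Laplacian part spreads this value to all nodes. *)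
rewrite lt_def addr_ge0 ?laplacian_ge0 ?sumr_ge0 // andbT.
apply: contra v0; rewrite paddr_eq0 ?laplacian_ge0 ?sumr_ge0 //.
move=> /andP[/eqP h]; rewrite psumr_eq0 // => /allP /(_ i (mem_index_enum i)) /=.
rewrite mxE mulf_eq0 gt_eqF ?mulr_gt0 // orFb sqrf_eq0 => /eqP vi.
by apply/eqP/rowP => j; rewrite (laplacian_kernel _ i) // vi mxE.
Qed.

End Laplacian.

(** * Convexity and existence for the leader selection problems *)

Section LeaderSelectionFacts.
Context (R : realType) (n : nat).
Implicit Types (L : 'M[R]_n) (kappa x y : 'rV[R]_n).

Lemma grounded_conv L kappa x y (t : R) :
  grounded L kappa (t *: x + (1 - t) *: y)
  = t *: grounded L kappa x + (1 - t) *: grounded L kappa y.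
Proof.
rewrite /grounded linearD !linearZ /= mulmxDr -!scalemxAr !scalerDr addrACA.
by rewrite -scalerDl subrKC scale1r.
Qed.

Lemma convex_set_J_domain L kappa : convex_set (J_domain L kappa).
Proof.
move=> x y t; rewrite !inE /J_domain /= => px py.
by rewrite grounded_conv; apply: posdefmx_conv => //; apply/andP; split.
Qed.

Lemma convex_function_J L kappa : convex_function (J_domain L kappa) (J L kappa).
Proof.
move=> t x y; rewrite !inE /J_domain /= => px py.
by rewrite /J grounded_conv; apply: mxtrace_invmx_conv => //; apply/andP; split.
Qed.

Lemma convex_set_relaxed (Nl : nat) : convex_set (@relaxed_feasible R n Nl).
Proof.
move=> x y t; rewrite !inE /relaxed_feasible /= => -[sx bx] [sy b_y]; split.
  under eq_bigr do rewrite !mxE.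
  by rewrite big_split -!mulr_sumr /= sx sy -mulrDl subrKC mul1r.
move=> i; rewrite !mxE; have t0 : 0 <= t%:num by []. have t1 : t%:num <= 1 by [].
have /andP[a b] := bx i; have /andP[c d] := b_y i.
by rewrite /unstable.onem; apply/andP; split; nra.
Qed.

Lemma leader_feasible_relaxed (Nl : nat) :
  @leader_feasible R n Nl `<=` @relaxed_feasible R n Nl.
Proof.
move=> x [bx sx]; split=> // i; case: (bx i) => ->; rewrite ?lexx ?ler01 //.
Qed.

(** Boolean vectors with sum [Nl] are the indicators of the [Nl]-element subsets of the nodes. There
    are finitely many of these, and at least one since the binomial coefficient is positive for [Nl]
    at most n, so any f attains its minimum. *)
Lemma leader_minimum (f : 'rV[R]_n -> R) (Nl : nat) : (Nl <= n)%N ->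
  exists v, minimum (@leader_feasible R n Nl) f v.
Proof.
move=> Nn; pose ind (A : {set 'I_n}) : 'rV[R]_n := \row_i (i \in A)%:R.
have indS A : \sum_i ind A 0 i = #|A|%:R.
  rewrite -sum1_card natr_sum [RHS]big_mkcond; apply: eq_bigr => i _.
  by rewrite mxE; case: (i \in A).
have ind_feas (A : {set 'I_n}) : #|A| = Nl -> leader_feasible Nl (ind A).
  move=> cA; split; last by rewrite indS cA.
  by move=> i; rewrite mxE; case: (i \in A); [right|left].
have feas_ind x : leader_feasible Nl x -> exists2 A : {set 'I_n}, #|A| = Nl & x = ind A.
  move=> [bx sx]; have xE : x = ind [set i | x 0 i == 1]%SET.
    apply/rowP => i; rewrite !mxE inE; case: (bx i) => ->; rewrite ?eqxx //.
    by rewrite eq_sym oner_eq0.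
  exists [set i | x 0 i == 1]%SET => //.
  by apply/eqP; rewrite -(eqr_nat R) -indS -xE sx.
have [A0 cA0] : exists A : {set 'I_n}, #|A| == Nl.
  have : (0 < #|[set A : {set 'I_n} | #|A| == Nl]%SET|)%N.
    by rewrite card_draws card_ord bin_gt0.
  by rewrite card_gt0 => /set0Pn[A]; rewrite inE; exists A.
have := @Order.TotalTheory.arg_minP _ _ _ A0
  (fun A : {set 'I_n} => #|A| == Nl) (fun A => f (ind A)) cA0.
case=> A /eqP cA minA.
exists (f (ind A)), (ind A) => //; split; first exact: ind_feas.
by move=> y /feas_ind[B /eqP cB ->]; apply: minA.
Qed.

End LeaderSelectionFacts.

Theorem mainTheorem1 (R : realType) (n : nat) (e : rel 'I_n)
    (e_sym : symmetric e) (e_irr : irreflexive e) (e_conn : connected_graph e)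
    (kappa : 'rV[R]_n) (kappa_gt0 : forall i, 0 < kappa 0 i)
    (Nl : nat) (Nl_bounds : (1 <= Nl < n)%N) :
  let L := laplacian R e in
  let Jx := J L kappa in
  (* (i) *)
  (convex_set (J_domain L kappa) /\ convex_function (J_domain L kappa) Jx)
  (* (ii) *)
  /\ (exists Jopt : R,
        minimum (@leader_feasible R n Nl) Jx Jopt
        /\ @relaxed_feasible R n Nl `<=` J_domain L kappa
        /\ convex_problem (@relaxed_feasible R n Nl) Jx
        /\ forall xs : 'rV[R]_n, solution (@relaxed_feasible R n Nl) Jx xs ->
             Jx xs <= Jopt
             /\ (boolean_vector xs -> solution (@leader_feasible R n Nl) Jx xs))
  (* (iii) *)
  /\ (optimal_value (@relaxed_feasible R n Nl) Jx
        = optimal_value (sdp_feasible L kappa Nl) (@sdp_objective R n)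
      /\ forall x : 'rV[R]_n,
           solution (@relaxed_feasible R n Nl) Jx x
           <-> exists X : 'M[R]_n,
                 solution (sdp_feasible L kappa Nl) (@sdp_objective R n) (X, x)).
Proof.
move=> L Jx; case/andP: Nl_bounds => Nl1 Nln.
(* This guarantees that [J] takes the trace of a genuine inverse at every relaxed feasible point. A
   positive entry exists because nonnegative entries, none of them positive, would sum to 0 rather
   than to [Nl], which is at least 1. *)
have dom : @relaxed_feasible R n Nl `<=` J_domain L kappa.
  move=> x [sx bx]; have x0 i : 0 <= x 0 i by case/andP: (bx i).
  have [i xi] : exists i, 0 < x 0 i.
    apply: contrapT => /forallNP h; have : 0 < \sum_i x 0 i.
      by rewrite sx ltr0n.
    rewrite big1 ?ltxx // => i _; apply/eqP; rewrite eq_le x0 andbT leNgt.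
    exact/negP.
  exact: (@grounded_posdef _ _ _ e_sym e_conn _ _ i).
split; first by split; [exact: convex_set_J_domain | exact: convex_function_J].
split.
  have [Jopt minJ] := @leader_minimum R n Jx Nl (ltnW Nln).
  exists Jopt; split=> //; split=> //; split.
    split; first exact: convex_set_relaxed.
    move=> t x y; rewrite !inE => fx fy.
    by apply: convex_function_J; rewrite inE; apply: dom.
  move=> xs [fxs mxs]; split.
    by case: minJ => x [/leader_feasible_relaxed fx _] <-; apply: mxs.
  move=> bxs; split; first by split=> //; case: fxs.
  by move=> y /leader_feasible_relaxed /mxs.
(* Part (iii) rests on two maps: dropping X lands in the relaxed problem without raising the
   objective, and adjoining the inverse of the grounded matrix lifts back with equal objective. *)
have sdp_relaxed X x : sdp_feasible L kappa Nl (X, x) ->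
    relaxed_feasible Nl x /\ Jx x <= \tr X.
  move=> [/= _ psd sx bx]; have fx : relaxed_feasible Nl x by split.
  by split=> //; apply: mxtrace_invmx_le_schur psd; apply: dom.
have relaxed_sdp x : relaxed_feasible Nl x ->
    sdp_feasible L kappa Nl (invmx (grounded L kappa x), x).
  move=> fx; have pd := dom _ fx; case: fx => sx bx; split=> //=.
    by apply/symmetricmxP; rewrite trmx_inv posdefmx_sym.
  exact: possemidefmx_schur_inv.
split.
  apply/eqP; rewrite eq_le; apply/andP; split; apply/ereal_infP => /=.
    move=> _ [[X x] /sdp_relaxed[fx le] <-]; apply: ge_ereal_inf.
    by exists (Jx x)%:E; [exists x | rewrite lee_fin].
  move=> _ [x /relaxed_sdp fx <-]; apply: ge_ereal_inf.
  by exists (Jx x)%:E => //; exists (invmx (grounded L kappa x), x).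
move=> x; split=> [[fx mx]|[X [/sdp_relaxed[fx le] mX]]].
  exists (invmx (grounded L kappa x)); split; first exact: relaxed_sdp.
  by move=> [Y y] /sdp_relaxed[/mx le1 le2]; apply: le_trans le1 le2.
(* Chain: J(x) is at most trace X, which by optimality is at most the objective at the lift of y,
   namely J(y). *)
by split=> // y fy; apply: le_trans le (mX _ (relaxed_sdp _ fy)).
Qed.
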